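(* (i) Let $S$ be a unital nonassociative ring with multiplication $\circ$ which has an associative subring $D$ that is a division algebra, such that $S$ is a free left $D$-module of rank $m$. Suppose that: (1) there is $t\in S$ such that $t^i$, $0\le i<m$, is a basis of $S$ over $D$, where $t^0=1$ and $t^{i+1}=t\circ t^i$; (2) for all $a\in D$, $a\ne0$, there is $a'\in D$, $a'\neq0$, such that $t\circ a=a'\circ t$; (3) for all $a,b,c\in D$, $i+j<m$, $k<m$, we have $[a\circ t^i,b\circ t^j,c\circ t^k]=0$; (4) $t^m=d$ with $d\in D$; (5) the map $\sigma:D\to D$, $\sigma(a)=a'$ (with $\sigma(0)=0$), has order $m$ and fixed set $\{a\in D\mid t\circ a=a\circ t\}$, $D$ is a central simple algebra over its center $F$, and $F_0=F\cap\mathrm{Fix}(\sigma)$ contains a primitive $m$th root of unity $\omega$. Then $S\cong S_f=(D,\sigma,d)$ with $f(t)=t^m-d\in D[t;\sigma]$. (ii) If moreover $S$ is a right division ring and $D$ is a central simple algebra, then $f$ is irreducible and $S$ is a nonassociative cyclic extension of $D$ of degree $m$.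
   Context: $[x,y,z]=(x\circ y)\circ z-x\circ(y\circ z)$ is the associator. $D[t;\sigma]$ is the twisted polynomial ring (polynomials $\sum a_it^i$, $a_i\in D$, multiplication determined by $ta=\sigma(a)t$); $(D,\sigma,d)=S_f$ is the set of polynomials of degree $<m$ with multiplication $g\circ h=$ remainder of $gh$ on right division by $f=t^m-d$. A nonassociative ring $S\ne0$ is a right division ring if right multiplication $x\mapsto x\circ a$ is bijective for every $a\neq0$. $f$ is irreducible if not a unit and not a product of two non-units. Definition: if $A$ is a nonassociative division algebra and $D\subseteq A$ an associative division subalgebra, $A$ is a nonassociative cyclic extension of $D$ of degree $m$ if $A$ is a free left $D$-module of rank $m$ and $\mathrm{Aut}(A)$ has a cyclic subgroup $G$ of order $m$ with $H|_D=\mathrm{id}_D$ for all $H\in G$. *)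

(* Defs.v *)
From HB Require Import structures.
From mathcomp Require Import all_boot all_order all_algebra.
Set Implicit Arguments. Unset Strict Implicit. Unset Printing Implicit Defensive.
Import GRing.Theory.
Local Open Scope ring_scope.

Section NonAssoc.
Context {S : zmodType} (mul : S -> S -> S) (one : S).

Definition nonassoc_unital_ring : Prop :=
  [/\ forall x y z, mul (x + y) z = mul x z + mul y z,
      forall x y z, mul x (y + z) = mul x y + mul x z,
      forall x, mul one x = x
    & forall x, mul x one = x].

Definition assoc (x y z : S) : S := mul (mul x y) z - mul x (mul y z).

Fixpoint npow (x : S) (n : nat) : S :=
  match n with 0 => one | n'.+1 => mul x (npow x n') end.

Definition assoc_division_subring (D : S -> Prop) : Prop :=
  [/\ D 0 /\ D one, one <> 0,
      (forall a b, D a -> D b -> D (a - b) /\ D (mul a b)),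
      (forall a b c, D a -> D b -> D c -> assoc a b c = 0)
    & forall a, D a -> a <> 0 -> exists b, [/\ D b, mul a b = one & mul b a = one]].

Definition left_module (D : S -> Prop) : Prop :=
  forall a b x, D a -> D b -> mul (mul a b) x = mul a (mul b x).

Definition is_basis (D : S -> Prop) (m : nat) (e : nat -> S) : Prop :=
  (forall x, exists c : nat -> S,
      (forall i, D (c i)) /\ x = \sum_(i < m) mul (c i) (e i)) /\
  (forall c : nat -> S, (forall i, D (c i)) ->
      \sum_(i < m) mul (c i) (e i) = 0 -> forall i, (i < m)%N -> c i = 0).

Definition free_left_module_rank (D : S -> Prop) (m : nat) : Prop :=
  left_module D /\ exists e : nat -> S, is_basis D m e.

Definition center (D : S -> Prop) (z : S) : Prop :=
  D z /\ forall a, D a -> mul z a = mul a z.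

Definition ideal_of (D I : S -> Prop) : Prop :=
  [/\ forall x, I x -> D x, I 0,
      (forall x y, I x -> I y -> I (x - y))
    & forall a x, D a -> I x -> I (mul a x) /\ I (mul x a)].

Definition central_simple_over_center (D : S -> Prop) : Prop :=
  [/\ one <> 0,
      (forall I, ideal_of D I -> (forall x, I x -> x = 0) \/ (forall x, D x -> I x))
    & exists (n : nat) (b : nat -> S), (forall i, D (b i)) /\
        forall a, D a -> exists c : nat -> S,
          (forall i, center D (c i)) /\ a = \sum_(i < n) mul (c i) (b i)].

Definition right_division_ring : Prop :=
  (exists x : S, x <> 0) /\ forall a, a <> 0 -> bijective (fun x => mul x a).

Definition division_ring : Prop :=
  (exists x : S, x <> 0) /\
  forall a, a <> 0 -> bijective (fun x => mul a x) /\ bijective (fun x => mul x a).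

Definition ring_automorphism (H : S -> S) : Prop :=
  [/\ bijective H, (forall x y, H (x + y) = H x + H y),
      (forall x y, H (mul x y) = mul (H x) (H y)) & H one = one].

(* Definition of nonassociative cyclic extension of D of degree m:
   S is a nonassociative division algebra, D an associative division subalgebra,
   S is a free left D-module of rank m, and Aut(S) has a cyclic subgroup of
   order m (i.e. one generated by an automorphism H of order m) all of whose
   elements restrict to the identity on D (equivalently, H does). *)
Definition nonassoc_cyclic_extension (D : S -> Prop) (m : nat) : Prop :=
  [/\ division_ring, assoc_division_subring D, free_left_module_rank D m
    & exists H : S -> S,
        [/\ ring_automorphism H, (forall a, D a -> H a = a),
            (forall x, iter m H x = x)
          & forall k, (0 < k < m)%N -> exists x, iter k H x <> x]].

(* a polynomial sum_i p_i t^i is represented by its coefficient function *)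
Definition tpoly := nat -> S.

Definition is_Dpoly (D : S -> Prop) (p : tpoly) : Prop :=
  (forall n, D (p n)) /\ exists N, forall n, (N <= n)%N -> p n = 0.

Definition tw_add (p q : tpoly) : tpoly := fun n => p n + q n.

(* (a t^i)(b t^j) = a sigma^i(b) t^(i+j) *)
Definition tw_mul (sigma : S -> S) (p q : tpoly) : tpoly :=
  fun n => \sum_(i < n.+1) mul (p i) (iter i sigma (q (n - i)%N)).

Definition tw_one : tpoly := fun n => if n == 0%N then one else 0.

Definition poly_f (m : nat) (d : S) : tpoly :=
  fun n => (if n == m then one else 0) - (if n == 0%N then d else 0).

Definition tw_unit (D : S -> Prop) (sigma : S -> S) (p : tpoly) : Prop :=
  is_Dpoly D p /\ exists q, [/\ is_Dpoly D q, tw_mul sigma p q = tw_one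
                                & tw_mul sigma q p = tw_one].

Definition tw_irreducible (D : S -> Prop) (sigma : S -> S) (f : tpoly) : Prop :=
  ~ tw_unit D sigma f /\
  ~ (exists g h, [/\ is_Dpoly D g, is_Dpoly D h, f = tw_mul sigma g h,
                     ~ tw_unit D sigma g & ~ tw_unit D sigma h]).

Definition Sf_elem (D : S -> Prop) (m : nat) (p : tpoly) : Prop :=
  (forall n, D (p n)) /\ forall n, (m <= n)%N -> p n = 0.

Definition is_rmod (D : S -> Prop) (sigma : S -> S) (m : nat) (f g r : tpoly) : Prop :=
  Sf_elem D m r /\ exists q, is_Dpoly D q /\ g = tw_add (tw_mul sigma q f) r.

(* S is isomorphic (as a ring) to S_f = (D, sigma, d), f = t^m - d,
   whose multiplication is g o h = (gh mod_r f) *)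
Definition iso_to_Sf (D : S -> Prop) (sigma : S -> S) (m : nat) (d : S) : Prop :=
  exists phi : S -> tpoly,
    [/\ (forall x, Sf_elem D m (phi x)),
        injective phi /\
        (forall p, Sf_elem D m p -> exists x, phi x = p),
        (forall x y, phi (x + y) = tw_add (phi x) (phi y)),
        phi one = tw_one
      & forall x y, is_rmod D sigma m (poly_f m d)
                      (tw_mul sigma (phi x) (phi y)) (phi (mul x y))].

End NonAssoc.

(* Main.v *)
Require Import Defs.
From mathcomp Require Import all_boot all_order all_algebra.
From mathcomp Require Import boolp.

(* The hypotheses determine the product of monomials,
   [a t^i o b t^j = a sigma^i(b) t^(i+j)] if [i + j < m] and
   [a sigma^i(b) sigma^(i+j-m)(d) t^(i+j-m)] otherwise, so that taking coordinates
   with respect to [1, t, ..., t^(m-1)] identifies [S] with [S_f].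
   A factorization of [f] into factors of positive degree gives zero divisors of [S],
   and [sum a_i t^i |-> sum a_i omega^i t^i] is an automorphism of order [m] fixing [D].
   For left division, note that [S] is a finite-dimensional right vector space over
   the center [F] of [D] and that left multiplications are right [F]-linear, because
   elements of [F] commute with [d] and [sigma^m = id]; being injective, they are surjective. *)

Set Implicit Arguments. Unset Strict Implicit. Unset Printing Implicit Defensive.
Import GRing.Theory.
Local Open Scope ring_scope.

(** * Preliminaries on bijections and double sums *)

Lemma inj_surj_bijective (A B : Type) (f : A -> B) :
  injective f -> (forall y, exists x, f x = y) -> bijective f.
Proof.
move=> f_inj /choice [g fgK]; exists g => // x; exact/f_inj/fgK.
Qed.

(** Every antidiagonal meeting the square [[0, m) x [0, m)] has index below [m + m], and [F]
    vanishes off the square. This turns the coefficients of a product of polynomials into a double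
    sum over pairs of monomials. *)
Lemma big_antidiagonal (V : zmodType) (m : nat) (F : nat -> nat -> V) :
  (forall i j, (m <= i)%N || (m <= j)%N -> F i j = 0) ->
  \sum_(n < m + m) \sum_(i < n.+1) F i (n - i)%N =
  \sum_(i < m) \sum_(j < m) F i j.
Proof.
move=> F0.
have -> : \sum_(n < m + m) \sum_(i < n.+1) F i (n - i)%N =
    \sum_(0 <= n < m + m) \sum_(0 <= i < m + m | (i <= n)%N) F i (n - i)%N.
  rewrite big_mkord; apply: eq_bigr => n _.
  rewrite -(big_mkord xpredT (fun i => F i (n - i)%N)).
  by rewrite (big_nat_widen 0 n.+1 (m + m)) ?ltn_ord.
rewrite (exchange_big_dep_nat xpredT) //= (@big_cat_nat _ _ _ m) ?leq_addr //=.
rewrite [X in _ + X]big1_seq ?addr0; last first.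
  move=> i /andP[_]; rewrite mem_index_iota => /andP[mi _].
  by rewrite big1 // => n _; rewrite F0 ?mi.
rewrite big_mkord; apply: eq_bigr => i _.
have -> : \sum_(0 <= n < m + m | (i <= n)%N) F i (n - i)%N =
    \sum_(i <= n < m + m) F i (n - i)%N.
  by rewrite [RHS](@big_nat_widenl _ _ _ i 0).
rewrite -{1}[i : nat]add0n big_addn.
under eq_bigr do rewrite addnK.
(* After the shift by [i] the inner range still covers all [j < m], and the rest contributes
   zero. *)
have im : (m <= m + m - i)%N by rewrite -addnBA ?leq_addr // ltnW.
rewrite (@big_cat_nat _ _ _ m) //= [X in _ + X]big1_seq ?addr0 ?big_mkord //.
by move=> j /andP[_]; rewrite mem_index_iota => /andP[mj _]; rewrite F0 ?mj ?orbT.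
Qed.

(** * Arithmetic in a unital nonassociative ring *)

Section NonassocRing.
Variables (S : zmodType) (mul : S -> S -> S) (one : S).
Hypothesis ringS : nonassoc_unital_ring mul one.

Lemma na_mulDl x y z : mul (x + y) z = mul x z + mul y z.
Proof. by case: ringS. Qed.

Lemma na_mulDr x y z : mul x (y + z) = mul x y + mul x z.
Proof. by case: ringS. Qed.

Lemma na_mul1 x : mul one x = x.
Proof. by case: ringS. Qed.

Lemma na_mulr1 x : mul x one = x.
Proof. by case: ringS. Qed.

Lemma na_mul0 x : mul 0 x = 0.
Proof. by apply: (addrI (mul 0 x)); rewrite -na_mulDl !addr0. Qed.

Lemma na_mulr0 x : mul x 0 = 0.
Proof. by apply: (addrI (mul x 0)); rewrite -na_mulDr !addr0. Qed.

Lemma na_mulrN x y : mul x (- y) = - mul x y.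
Proof. by apply: (addrI (mul x y)); rewrite -na_mulDr !subrr na_mulr0. Qed.

Lemma na_mulNr x y : mul (- x) y = - mul x y.
Proof. by apply: (addrI (mul x y)); rewrite -na_mulDl !subrr na_mul0. Qed.

Lemma na_mulBr x y z : mul x (y - z) = mul x y - mul x z.
Proof. by rewrite na_mulDr na_mulrN. Qed.

Lemma na_mulBl x y z : mul (x - y) z = mul x z - mul y z.
Proof. by rewrite na_mulDl na_mulNr. Qed.

Lemma na_mul_suml I (r : seq I) (P : pred I) (F : I -> S) x :
  mul (\sum_(i <- r | P i) F i) x = \sum_(i <- r | P i) mul (F i) x.
Proof. exact: (big_morph (mul^~ x) (fun y z => na_mulDl y z x) (na_mul0 x)). Qed.

Lemma na_mul_sumr I (r : seq I) (P : pred I) (F : I -> S) x :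
  mul x (\sum_(i <- r | P i) F i) = \sum_(i <- r | P i) mul x (F i).
Proof. exact: (big_morph (mul x) (na_mulDr x) (na_mulr0 x)). Qed.

(** * Descending chains in a finitely spanned right vector space over [K] *)

Section DescendingChains.
Variable K : S -> Prop.
Hypotheses (K0 : K 0) (KB : forall a b, K a -> K b -> K (a - b))
  (KM : forall a b, K a -> K b -> K (mul a b))
  (KV : forall a, K a -> a <> 0 -> exists2 b, K b & mul a b = one)
  (actA : forall x a b, K a -> K b -> mul (mul x a) b = mul x (mul a b)).

Definition right_subspace (W : S -> Prop) :=
  [/\ W 0, forall x y, W x -> W y -> W (x - y) & forall x a, W x -> K a -> W (mul x a)].

Definition right_span (I : Type) (e : I -> S) (r : seq I) (x : S) :=
  exists c : I -> S, (forall i, K (c i)) /\ x = \sum_(i <- r) mul (e i) (c i).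

Lemma right_subspace_span I (e : I -> S) r : right_subspace (right_span e r).
Proof.
split.
- by exists (fun=> 0); split=> //; rewrite big1 // => i _; rewrite na_mulr0.
- move=> x y [c [Kc ->]] [c' [Kc' ->]].
  exists (fun i => c i - c' i); split=> [i|]; first exact: KB.
  by rewrite -sumrB; apply: eq_bigr => i _; rewrite na_mulBr.
- move=> x a [c [Kc ->]] Ka; exists (fun i => mul (c i) a); split=> [i|]; first exact: KM.
  rewrite na_mul_suml.
  by apply: eq_bigr => i _; rewrite actA.
Qed.

(* Induction on the generators: if no W_n lies in the span U of all but one of
   them, every W_n contains a vector outside U, so that W_(n+1) = W_n as soon as
   their traces on U agree. *)
Lemma descending_chain_stops I (e : I -> S) r (W : nat -> S -> Prop) :
  (forall n, right_subspace (W n)) -> (forall n x, W n.+1 x -> W n x) ->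
  (forall n x, W n x -> right_span e r x) ->
  exists n, forall x, W n x -> W n.+1 x.
Proof.
elim: r W => [|i r IHr] W subW decW spanW.
  exists 0%N => x /spanW[c [_ ->]]; rewrite big_nil.
  by case: (subW 1%N).
have [[n Wn]|noW] := pselect (exists n, forall x, W n x -> right_span e r x).
  have [||k x Wx|k Wk] := IHr (fun k => W (n + k)%N).
  - by move=> k; apply: subW.
  - by move=> k x; rewrite addnS; apply: decW.
  - by apply: Wn; elim: k Wx => [|k IHk]; rewrite ?addn0 // addnS => /decW.
  - by exists (n + k)%N => x; rewrite -addnS; apply: Wk.
have [U0 UB UM] := right_subspace_span e r.
have [||k x []//|n Wn] := IHr (fun k x => W k x /\ right_span e r x).
- move=> k; have [W0 WB WM] := subW k; split=> //.
  + by move=> x y [Wx Ux] [Wy Uy]; split; [apply: WB | apply: UB].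
  + by move=> x a [Wx Ux] Ka; split; [apply: WM | apply: UM].
- by move=> k x [/decW].
exists n => x Wx.
(* Otherwise [W n.+1] would lie in the span of [r], the case excluded by [noW]. *)
have [w Ww nUw] : exists2 w, W n.+1 w & ~ right_span e r w.
  by apply/existsPNP => WU; apply: noW; exists n.+1.
have [_ WBn _] := subW n; have [W0 WB WM] := subW n.+1.
have [c [Kc xE]] := spanW _ _ Wx; have [b [Kb wE]] := spanW _ _ Ww.
rewrite big_cons in xE; rewrite big_cons in wE.
have Uc : right_span e r (\sum_(j <- r) mul (e j) (c j)) by exists c.
have Ub : right_span e r (\sum_(j <- r) mul (e j) (b j)) by exists b.
have bi0 : b i <> 0 by move=> b0; apply: nUw; rewrite wE b0 na_mulr0 add0r.
have [v Kv bv] := KV (Kb i) bi0.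
(* The scalar [l] solves [b_i l = c_i], so that [x - w l] has no [e_i] term and lies in the span of
   [r]. *)
set l := mul v (c i); have Kl : K l by apply: KM.
have blE : mul (b i) l = c i by rewrite -actA // bv na_mul1.
have Wxw : W n (x - mul w l) by apply: WBn => //; apply/decW/WM.
have Uxw : right_span e r (x - mul w l).
  rewrite xE wE na_mulDl actA // blE opprD addrACA subrr add0r.
  by apply: UB => //; apply: UM.
have [Wxw1 _] := Wn _ (conj Wxw Uxw).
have -> : x = (x - mul w l) - (0 - mul w l) by rewrite sub0r opprK subrK.
by apply: (WB) => //; apply: (WB) => //; apply: WM.
Qed.

(** The images of the iterates of [L] form a descending chain of subspaces. Where it stops,
    [L^n y = L^(n+1) x] for some [x], and injectivity cancels [L^n]. *)
Lemma right_linear_inj_surj I (e : I -> S) r (L : S -> S) :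
  (forall x, right_span e r x) -> (forall x y, L (x + y) = L x + L y) ->
  (forall x a, K a -> L (mul x a) = mul (L x) a) -> injective L ->
  forall y, exists x, L x = y.
Proof.
move=> spanS LD LM L_inj y.
have L0 : L 0 = 0 by apply: (addrI (L 0)); rewrite -LD !addr0.
have LB x z : L (x - z) = L x - L z by rewrite -{2}(subrK z x) [in RHS]LD addrK.
have iterL0 n : iter n L 0 = 0 by elim: n => //= n ->.
have iterLB n x z : iter n L (x - z) = iter n L x - iter n L z by elim: n => //= n ->.
have iterLM n x a : K a -> iter n L (mul x a) = mul (iter n L x) a.
  by move=> Ka; elim: n => //= n ->; apply: LM.
have [||//|n Ln] := @descending_chain_stops I e r (fun n x => exists z, x = iter n L z).
- move=> n; split; first by exists 0.
    by move=> _ _ [x ->] [z ->]; exists (x - z).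
  by move=> _ a [x ->] Ka; exists (mul x a); rewrite iterLM.
- by move=> n _ [x ->]; exists (L x); rewrite iterSr.
have [x] := Ln _ (ex_intro _ y erefl); rewrite iterSr => yx; exists x.
by elim: n yx {Ln} => //= n IHn /L_inj /IHn.
Qed.

End DescendingChains.
End NonassocRing.

(** * The division ring [D] and the map [sigma] *)

Section CyclicAlgebra.
Variables (S : zmodType) (mul : S -> S -> S) (one : S) (D : S -> Prop) (m : nat).
Variables (t d : S) (sigma : S -> S).
Local Infix "**" := mul (at level 40, left associativity).
Local Notation "t ^^ i" := (npow mul one t i) (at level 30).
Hypotheses (ringS : nonassoc_unital_ring mul one)
  (divD : assoc_division_subring mul one D)
  (modS : left_module mul D)
  (basis_t : is_basis mul D m (npow mul one t))
  (assoc_t : forall a b c i j k, D a -> D b -> D c -> (i + j < m)%N -> (k < m)%N ->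
     assoc mul (a ** (t ^^ i)) (b ** (t ^^ j)) (c ** (t ^^ k)) = 0)
  (Dd : D d) (powtm : t ^^ m = d)
  (sigma0 : sigma 0 = 0)
  (sigmaP : forall a, D a -> a <> 0 ->
     [/\ D (sigma a), sigma a <> 0 & t ** a = sigma a ** t])
  (m_gt0 : (0 < m)%N)
  (iter_sigma_m : forall a, D a -> iter m sigma a = a).

Local Notation mul0 := (na_mul0 ringS).
Local Notation mulr0 := (na_mulr0 ringS).
Local Notation mul1 := (na_mul1 ringS).
Local Notation mulr1 := (na_mulr1 ringS).
Local Notation mulDl := (na_mulDl ringS).
Local Notation mulDr := (na_mulDr ringS).
Local Notation mulBl := (na_mulBl ringS).

Lemma D0 : D 0. Proof. by case: divD => [[]]. Qed.
Lemma D1 : D one. Proof. by case: divD => [[]]. Qed.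
Lemma one_neq0 : one <> 0. Proof. by case: divD. Qed.

Lemma DB a b : D a -> D b -> D (a - b).
Proof. by case: divD => _ _ DBM _ _ Da Db; case: (DBM a b). Qed.

Lemma DM a b : D a -> D b -> D (a ** b).
Proof. by case: divD => _ _ DBM _ _ Da Db; case: (DBM a b). Qed.

Lemma DN a : D a -> D (- a).
Proof. by move=> Da; rewrite -sub0r; apply: DB => //; apply: D0. Qed.

Lemma DD a b : D a -> D b -> D (a + b).
Proof. by move=> Da Db; rewrite -[b]opprK; apply: DB => //; apply: DN. Qed.

Lemma D_sum I (r : seq I) (P : pred I) (F : I -> S) :
  (forall i, P i -> D (F i)) -> D (\sum_(i <- r | P i) F i).
Proof. by move=> DF; apply: big_ind => //; [apply: D0 | apply: DD]. Qed.

Lemma DV a : D a -> a <> 0 -> exists b, [/\ D b, a ** b = one & b ** a = one].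
Proof. by case: divD => _ _ _ _; apply. Qed.

Lemma D_eq0 a b : D a -> D b -> a ** b = 0 -> a = 0 \/ b = 0.
Proof.
move=> Da Db ab0; have [->|/eqP/(DV Da)[c [Dc _ ca]]] := eqVneq a 0; first by left.
by right; rewrite -[b]mul1 -ca modS // ab0 mulr0.
Qed.

Lemma D_sigma a : D a -> D (sigma a).
Proof.
by move=> Da; have [->|/eqP a0] := eqVneq a 0; [rewrite sigma0; apply: D0 | case: (sigmaP Da a0)].
Qed.

Lemma mul_t a : D a -> t ** a = sigma a ** t.
Proof.
move=> Da; have [->|/eqP a0] := eqVneq a 0; last by case: (sigmaP Da a0).
by rewrite sigma0 mulr0 mul0.
Qed.

Lemma D_iter n a : D a -> D (iter n sigma a).
Proof. by move=> Da; elim: n => //= n; apply: D_sigma. Qed.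

Lemma iter0 n : iter n sigma 0 = 0.
Proof. by elim: n => //= n ->. Qed.

Lemma iter_neq0 n a : D a -> a <> 0 -> iter n sigma a <> 0.
Proof. by move=> Da a0; elim: n => //= n IHn; case: (sigmaP (D_iter n Da) IHn). Qed.

Lemma iter_addm n a : D a -> iter (n + m) sigma a = iter n sigma a.
Proof. by move=> Da; rewrite iterD iter_sigma_m. Qed.

Lemma coef_uniq (b c : nat -> S) : (forall i, D (b i)) -> (forall i, D (c i)) ->
  \sum_(i < m) b i ** (t ^^ i) = \sum_(i < m) c i ** (t ^^ i) ->
  forall i, (i < m)%N -> b i = c i.
Proof.
move=> Db Dc /eqP; rewrite -subr_eq0 -sumrB => /eqP bc0 i im.
apply/eqP; rewrite -subr_eq0; apply/eqP.
case: basis_t => _ free; apply: (free (fun i => b i - c i)) => // [j|]; first exact: DB.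
by rewrite -[RHS]bc0; apply: eq_bigr => j _; rewrite mulBl.
Qed.

(** For [1 < m] the element [t] is itself a basis vector. For [m = 1] it equals [d], which may be
    zero. *)
Lemma t_cancel a b : (1 < m)%N -> D a -> D b -> a ** t = b ** t -> a = b.
Proof.
move=> m1 Da Db abt.
pose e a i := if i == 1%N then a else 0 : S.
have De c i : D c -> D (e c i) by rewrite /e; case: eqP => // _ _; apply: D0.
have eE c : \sum_(i < m) e c i ** (t ^^ i) = c ** t.
  rewrite (bigD1 (Ordinal m1)) //= big1 ?addr0 ?mulr1 // => i i1.
  by rewrite /e ifN ?mul0 //; apply: contra i1.
by apply: (@coef_uniq (e a) (e b) _ _ _ 1%N) => // [i|i|]; [exact: De | exact: De | rewrite !eE].
Qed.

(** The tool for proving identities of [sigma]: for [1 < m] the relation [t a = b t] determines [b].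
    For [m = 1] the condition [sigma^m = id] makes [sigma] trivial on [D], whence the extra
    premise. *)
Lemma sigma_uniq a b : D a -> D b -> (m = 1%N -> a = b) -> t ** a = b ** t -> sigma a = b.
Proof.
move=> Da Db ab tab; have [m1|m1] := ltnP 1 m.
  by apply: t_cancel => //; [apply: D_sigma | rewrite -mul_t].
have m_eq1 : m = 1%N by apply/eqP; rewrite eqn_leq m1.
by move: (iter_sigma_m Da); rewrite m_eq1 /= => ->; apply: ab.
Qed.

Lemma sigma_id1 a : D a -> m = 1%N -> sigma a = a.
Proof. by move=> Da m1; have := iter_sigma_m Da; rewrite m1. Qed.

Lemma sigmaD a b : D a -> D b -> sigma (a + b) = sigma a + sigma b.
Proof.
move=> Da Db; apply: sigma_uniq => [|||]; first exact: DD.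
- by apply: DD; apply: D_sigma.
- by move=> m1; rewrite !sigma_id1.
- by rewrite mulDr !mul_t // mulDl.
Qed.

Lemma mulA_t a b c i j k : D a -> D b -> D c -> (i + j < m)%N -> (k < m)%N ->
  (a ** (t ^^ i)) ** (b ** (t ^^ j)) ** (c ** (t ^^ k)) =
  (a ** (t ^^ i)) ** ((b ** (t ^^ j)) ** (c ** (t ^^ k))).
Proof. by move=> Da Db Dc ij k_lt; apply/subr0_eq/assoc_t. Qed.

Lemma mulA_tD b c i k : D b -> D c -> (i < m)%N -> (k < m)%N ->
  (t ^^ i) ** b ** (c ** (t ^^ k)) = (t ^^ i) ** (b ** (c ** (t ^^ k))).
Proof.
move=> Db Dc i_lt k_lt; have := @mulA_t one b c i 0 k D1 Db Dc.
by rewrite addn0 /= mul1 mulr1; apply.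
Qed.

(** For [1 < m], associativity on monomials gives [t (a b) = (t a) b = (sigma(a) t) b = sigma(a) (t
    b) = sigma(a) sigma(b) t]. *)
Lemma sigmaM a b : D a -> D b -> sigma (a ** b) = sigma a ** sigma b.
Proof.
move=> Da Db; have [m1|m1] := ltnP 1 m; last first.
  have m_eq1 : m = 1%N by apply/eqP; rewrite eqn_leq m1.
  by rewrite !sigma_id1 //; apply: DM.
have Ds := D_sigma.
apply: sigma_uniq => [|||]; [exact: DM | by apply: DM; apply: Ds | by move=> m1'; rewrite m1' in m1 |].
have := @mulA_tD a b 1 0 Da Db m1 m_gt0; rewrite /= !mulr1 => <-.
rewrite mul_t //.
have := @mulA_t (sigma a) one b 0 1 0 (Ds _ Da) D1 Db m1 m_gt0.
by rewrite /= !mulr1 mul1 => ->; rewrite mul_t // modS //; apply: Ds.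
Qed.

(** By multiplicativity [sigma one] is a nonzero idempotent of [D], which has no zero divisors. *)
Lemma sigma1 : sigma one = one.
Proof.
have Ds1 := D_sigma D1.
have : (sigma one - one) ** sigma one = 0.
  by rewrite mulBl -sigmaM ?mul1 ?subrr //; apply: D1.
case/D_eq0 => //; first by apply: DB => //; apply: D1.
  by move/subr0_eq.
by case: (sigmaP D1 one_neq0).
Qed.

Lemma iterD_sigma n a b : D a -> D b -> iter n sigma (a + b) = iter n sigma a + iter n sigma b.
Proof. by move=> Da Db; elim: n => //= n ->; rewrite sigmaD //; apply: D_iter. Qed.

Lemma iterM n a b : D a -> D b -> iter n sigma (a ** b) = iter n sigma a ** iter n sigma b.
Proof. by move=> Da Db; elim: n => //= n ->; rewrite sigmaM //; apply: D_iter. Qed.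

Lemma iter1 n : iter n sigma one = one.
Proof. by elim: n => //= n ->; apply: sigma1. Qed.

Lemma iterN n a : D a -> iter n sigma (- a) = - iter n sigma a.
Proof.
move=> Da; apply: (addrI (iter n sigma a)).
by rewrite -iterD_sigma ?subrr ?iter0 //; apply: DN.
Qed.

(** * Products of monomials *)

Lemma powt_scalar i b : (i < m)%N -> D b -> (t ^^ i) ** b = iter i sigma b ** (t ^^ i).
Proof.
move=> + Db; elim: i => [|i IHi] i_lt; first by rewrite /= mul1 mulr1.
have m1 : (1 < m)%N by apply: leq_trans i_lt.
have := @mulA_t one one b 1 i 0 D1 D1 Db i_lt m_gt0.
rewrite /= !mulr1 !mul1 => ->; rewrite IHi 1?ltnW //.
have Dib := D_iter i Db.
(* Now [t (sigma^i(b) t^i)] is regrouped so that [t] passes the scalar, and then back to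
   [sigma^(i+1)(b) (t t^i)]. *)
have := @mulA_tD (iter i sigma b) one 1 i Dib D1 m1 (ltnW i_lt).
rewrite /= mulr1 mul1 => <-; rewrite mul_t //.
have := @mulA_t (sigma (iter i sigma b)) one one 0 1 i (D_sigma Dib) D1 D1 m1 (ltnW i_lt).
by rewrite /= !mulr1 !mul1 => ->.
Qed.

(* The normal form of [t^n], also for [m <= n < 2m], where [t^n = t^(n-m) d]. *)
Definition reduced_pow n := if (n < m)%N then t ^^ n else iter (n - m) sigma d ** (t ^^ (n - m)).

Lemma powt_mul i j : (i < m)%N -> (j < m)%N -> (t ^^ i) ** (t ^^ j) = reduced_pow (i + j).
Proof.
move=> + j_lt; elim: i => [|i IHi] i_lt; first by rewrite mul1 /reduced_pow j_lt.
have m1 : (1 < m)%N by apply: leq_trans i_lt.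
have := @mulA_t one one one 1 i j D1 D1 D1 i_lt j_lt.
rewrite /= !mulr1 !mul1 => ->; rewrite IHi 1?ltnW // addSn /reduced_pow.
(* Below [m] the power just grows. Above [m] the new [t] must pass the scalar [sigma^k(d)]. At [m]
   the power [t^m] becomes [d]. *)
case: (ltngtP (i + j).+1 m) => [ij|ij|ij].
- by [].
- rewrite subSn -1?ltnS //.
  have ijm : (i + j - m < m)%N.
    by rewrite ltn_subLR; [rewrite -addnS leq_add // ltnW // ltnW | rewrite -ltnS].

  set k := (i + j - m)%N.
  have Dk := D_iter k Dd.
  have := @mulA_tD (iter k sigma d) one 1 k Dk D1 m1 ijm.
  rewrite /= mulr1 mul1 => <-; rewrite mul_t //.
  have := @mulA_t (sigma (iter k sigma d)) one one 0 1 k (D_sigma Dk) D1 D1 m1 ijm.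
  by rewrite /= !mulr1 !mul1 => ->.
- by rewrite ij subnn /= mulr1 -powtm -ij.
Qed.

(** The product is regrouped as [a ((t^i b) t^j) = a (sigma^i(b) (t^i t^j))]. Each use of
    associativity has a zero exponent in one of its first two factors, so [i + j] may exceed [m]. *)
Lemma monomial_mul a b i j : D a -> D b -> (i < m)%N -> (j < m)%N ->
  (a ** (t ^^ i)) ** (b ** (t ^^ j)) = a ** iter i sigma b ** reduced_pow (i + j).
Proof.
move=> Da Db i_lt j_lt; have Dib := D_iter i Db.
have := @mulA_t a one b 0 i j Da D1 Db i_lt j_lt; rewrite /= mulr1 mul1 => ->.
have := @mulA_tD b one i j Db D1 i_lt j_lt; rewrite mul1 => <-; rewrite powt_scalar //.
have := @mulA_t (iter i sigma b) one one 0 i j Dib D1 D1 i_lt j_lt.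
by rewrite /= !mulr1 !mul1 => ->; rewrite powt_mul // modS.
Qed.

(** * Coordinates with respect to the powers of [t] *)

Lemma coord_exists x : exists c : nat -> S,
  [/\ forall i, D (c i), forall i, (m <= i)%N -> c i = 0 & x = \sum_(i < m) c i ** (t ^^ i)].
Proof.
case: basis_t => span _; have [c [Dc ->]] := span x.
exists (fun i => if (i < m)%N then c i else 0); split=> [i|i mi|].
- by case: ifP => // _; apply: D0.
- by rewrite ltnNge mi.
- by apply: eq_bigr => i _; rewrite ltn_ord.
Qed.

(** The coefficients vanish from [m] on, so that they form a polynomial of degree below [m] and are
    unique as a function. *)
Definition coord x := sval (cid (coord_exists x)).

Lemma D_coord x i : D (coord x i).
Proof. by rewrite /coord; case: cid => c /= []. Qed.

Lemma coord_ge x i : (m <= i)%N -> coord x i = 0.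
Proof. by rewrite /coord; case: cid => c /= [_ + _]; apply. Qed.

Lemma coordK x : \sum_(i < m) coord x i ** (t ^^ i) = x.
Proof. by rewrite /coord; case: cid => c /= []. Qed.

Lemma coord_sum c : (forall i, D (c i)) -> (forall i, (m <= i)%N -> c i = 0) ->
  coord (\sum_(i < m) c i ** (t ^^ i)) = c.
Proof.
move=> Dc c0; apply/funext => i; have [i_lt|mi] := ltnP i m; last by rewrite coord_ge ?c0.
by apply: coef_uniq i_lt => //; [apply: D_coord | rewrite coordK].
Qed.

Lemma coord_inj : injective coord.
Proof. by move=> x y xy; rewrite -[x]coordK xy coordK. Qed.

Lemma coordD x y : coord (x + y) = tw_add (coord x) (coord y).
Proof.
rewrite -{1}[x]coordK -{1}[y]coordK -big_split /=.
under eq_bigr do rewrite -mulDl.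
apply: coord_sum => i; first by apply: DD; apply: D_coord.
by move=> mi; rewrite /tw_add !coord_ge ?addr0.
Qed.

Lemma coord0 : coord 0 = fun=> 0.
Proof.
rewrite -[RHS](@coord_sum (fun=> 0)) => [|_|//]; last exact: D0.
by congr coord; rewrite big1 // => i _; rewrite mul0.
Qed.

Lemma coord_scalar a : D a -> coord a = fun n => if n == 0%N then a else 0.
Proof.
move=> Da; rewrite -[RHS]coord_sum.
- congr coord; rewrite (bigD1 (Ordinal m_gt0)) //= big1 ?addr0 ?mulr1 // => i i0.
  by rewrite ifN ?mul0 //; apply: contra i0.
- by move=> i; case: ifP => // _; apply: D0.
- by case=> //; rewrite leqNgt m_gt0.
Qed.

(* Since [t^(n+m) = t^n (t^m - d) + sigma^n(d) t^n], these are the coefficients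
   of the remainder modulo [t^m - d] of a polynomial of degree less than [2m]. *)
Definition reduce (g : tpoly) : tpoly :=
  fun n => if (n < m)%N then g n + g (n + m)%N ** iter n sigma d else 0.

Lemma D_tw_mul (p q : tpoly) n :
  (forall i, D (p i)) -> (forall i, D (q i)) -> D (tw_mul mul sigma p q n).
Proof. by move=> Dp Dq; apply: D_sum => i _; apply: DM => //; apply: D_iter. Qed.

(** Expanding both factors gives a double sum of monomial products. Collecting them by total
    exponent [n < 2m] yields the coefficients of the twisted product, and [reduced_pow] folds the
    upper half onto the lower one. *)
Lemma coordM x y : coord (x ** y) = reduce (tw_mul mul sigma (coord x) (coord y)).
Proof.
set g := tw_mul _ _ _ _.
have Dg n : D (g n) by apply: D_tw_mul; apply: D_coord.
suff -> : x ** y = \sum_(n < m) reduce g n ** (t ^^ n).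
  apply: coord_sum => n; rewrite /reduce; last by rewrite ltnNge => ->.
  case: ifP => _; last exact: D0.
  by apply: DD => //; apply: DM => //; apply: D_iter.
transitivity (\sum_(n < m + m) g n ** reduced_pow n); last first.
  rewrite big_split_ord /= -big_split /=; apply: eq_bigr => n _.
  rewrite /reduce /reduced_pow ltn_ord ltnNge leq_addr /= addKn addnC mulDl modS //.
  exact: D_iter.
pose F i j := coord x i ** iter i sigma (coord y j) ** reduced_pow (i + j).
transitivity (\sum_(i < m) \sum_(j < m) F i j).
  rewrite -{1}[x]coordK -{1}[y]coordK (na_mul_suml ringS).
  apply: eq_bigr => i _; rewrite (na_mul_sumr ringS); apply: eq_bigr => j _.
  by rewrite monomial_mul //; apply: D_coord.
rewrite -big_antidiagonal => [|i j].
  apply: eq_bigr => n _; rewrite (na_mul_suml ringS).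
  by apply: eq_bigr => i _; rewrite /F subnKC // -ltnS.
by rewrite /F => /orP[] le; rewrite (coord_ge _ le) ?iter0 ?mulr0 ?mul0.
Qed.

(** * Right division by [t^m - d] and the isomorphism with [S_f] *)

Lemma iter_poly_f i k : iter i sigma (poly_f one m d k) =
  (if k == m then one else 0) - (if k == 0%N then iter i sigma d else 0).
Proof.
rewrite /poly_f; case: eqP => [->|_]; first by rewrite gtn_eqF // !subr0 iter1.
by rewrite !sub0r iterN; case: eqP => // _; rewrite ?iter0 //; apply: D0.
Qed.

(** The two terms come from [q t^m], a shift by [m], and from [q d], where
    [t^n d = sigma^n(d) t^n]. *)
Lemma tw_mul_f (q : tpoly) n : tw_mul mul sigma q (poly_f one m d) n =
  (if (m <= n)%N then q (n - m)%N else 0) - q n ** iter n sigma d.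
Proof.
rewrite /tw_mul; under eq_bigr do rewrite iter_poly_f (na_mulBr ringS).
rewrite sumrB; congr (_ - _); last first.
  rewrite big_ord_recr /= subnn eqxx big1 ?add0r // => i _.
  by rewrite ifN ?mulr0 // -lt0n subn_gt0.
case: ifP => [mn|/negbT nm].
  have k_lt : (n - m < n.+1)%N by rewrite ltnS leq_subr.
  rewrite (bigD1 (Ordinal k_lt)) //= subKn // eqxx mulr1 big1 ?addr0 // => i ik.
  rewrite ifN ?mulr0 //; apply: contra ik => /eqP nim; apply/eqP/val_inj.
  by rewrite /= -nim subKn // -ltnS.
rewrite big1 // => i _; rewrite ifN ?mulr0 //; apply: contra nm => /eqP <-.
exact: leq_subr.
Qed.

Lemma tw_mul_coord_ge x y n : (m + m <= n)%N -> tw_mul mul sigma (coord x) (coord y) n = 0.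
Proof.
move=> mn; rewrite /tw_mul big1 // => i _.
have [mi|im] := leqP m i; first by rewrite coord_ge ?mul0.
rewrite [coord y _]coord_ge ?iter0 ?mulr0 //.
have i_le : (i <= n)%N by rewrite -ltnS.
by rewrite leq_subRL // (leq_trans _ mn) // leq_add2r ltnW.
Qed.

Lemma coord_iso : iso_to_Sf mul one D sigma m d.
Proof.
exists coord; split.
- by move=> x; split; [apply: D_coord | apply: coord_ge].
- split; first exact: coord_inj.
  by move=> p [Dp p0]; exists (\sum_(i < m) p i ** (t ^^ i)); apply: coord_sum.
- exact: coordD.
- exact/coord_scalar/D1.
move=> x y; split; first by split; [apply: D_coord | apply: coord_ge].
(* The quotient is the upper half of [g]: since [g] has degree below [2m], a single replacement of
   [t^(n+m)] by [sigma^n(d) t^n] leaves the remainder. *)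
set g := tw_mul mul sigma _ _; exists (fun n => g (n + m)%N); split.
  split=> [n|]; first by apply: D_tw_mul; apply: D_coord.
  by exists m => n mn; apply: tw_mul_coord_ge; rewrite leq_add2r.
apply/funext => n; rewrite /tw_add tw_mul_f coordM -/g /reduce.
case: (ltnP n m) => [nm|mn]; first by rewrite sub0r addrC addrK.
by rewrite subnK // [g (n + m)%N]tw_mul_coord_ge ?leq_add2r // mul0 subr0 addr0.
Qed.

(** * Degrees and irreducibility of [t^m - d] *)

Lemma tw_mul_top (p q : tpoly) a b : (forall i, (a < i)%N -> p i = 0) ->
  (forall i, (b < i)%N -> q i = 0) ->
  tw_mul mul sigma p q (a + b)%N = p a ** iter a sigma (q b).
Proof.
move=> pa qb; have a_lt : (a < (a + b).+1)%N by rewrite ltnS leq_addr.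
rewrite /tw_mul (bigD1 (Ordinal a_lt)) //= addKn big1 ?addr0 // => i ia.
case: (ltngtP i a) => [lt|gt|eq]; last by case/eqP: ia; apply: val_inj.
  rewrite qb ?iter0 ?mulr0 //.
  by rewrite ltn_subRL ltn_add2r.
by rewrite pa ?mul0.
Qed.

Lemma Dpoly_degree (p : tpoly) : is_Dpoly D p -> p <> (fun=> 0) ->
  exists N, p N <> 0 /\ forall n, (N < n)%N -> p n = 0.
Proof.
move=> [_ [N]]; elim: N => [|N IHN] pN p0; first by case: p0; apply/funext => n; apply: pN.
have [pN0|/eqP pN0] := eqVneq (p N) 0; last by exists N; split=> // n; apply: pN.
by apply: IHN => // n; rewrite leq_eqVlt => /predU1P[<-|/pN].
Qed.

Lemma tw_mul_const a b :
  tw_mul mul sigma (fun n => if n == 0%N then a else 0) (fun n => if n == 0%N then b else 0) =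
  fun n => if n == 0%N then a ** b else 0.
Proof.
apply/funext => n; rewrite /tw_mul big_ord_recl /= subn0 big1 ?addr0 => [|i _].
  by case: ifP => _ //; rewrite mulr0.
by rewrite mul0.
Qed.

Lemma const_unit (p : tpoly) : is_Dpoly D p -> p 0%N <> 0 ->
  (forall n, (0 < n)%N -> p n = 0) -> tw_unit mul one D sigma p.
Proof.
move=> Dp p0 pn; split=> //; have [b [Db pb bp]] := DV (proj1 Dp 0%N) p0.
have pE : p = fun n => if n == 0%N then p 0%N else 0.
  by apply/funext => -[|n] //; apply: pn.
exists (fun n => if n == 0%N then b else 0); split.
- split=> [n|]; first by case: ifP => // _; apply: D0.
  by exists 1%N => -[].
- by rewrite pE tw_mul_const pb.
- by rewrite pE tw_mul_const bp.
Qed.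

Lemma poly_f_top : poly_f one m d m = one.
Proof. by rewrite /poly_f eqxx gtn_eqF // subr0. Qed.

Lemma poly_f_gt n : (m < n)%N -> poly_f one m d n = 0.
Proof. by move=> mn; rewrite /poly_f !gtn_eqF ?subr0 // (leq_trans _ mn). Qed.

(** If [q] has degree [b], then [f q] has a nonzero coefficient in the positive degree [m + b]. *)
Lemma poly_f_nonunit : ~ tw_unit mul one D sigma (poly_f one m d).
Proof.
case=> _ [q [Dq fq _]].
have q0 : q <> fun=> 0.
  move=> q0; apply: one_neq0; have /(congr1 (@^~ 0%N)) := fq.
  by rewrite q0 /tw_one /= => <-; rewrite /tw_mul big1 // => i _; rewrite iter0 mulr0.
have [b [qb qtop]] := Dpoly_degree Dq q0.
have := tw_mul_top poly_f_gt qtop; rewrite fq poly_f_top mul1 /tw_one.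
rewrite gtn_eqF ?addn_gt0 ?m_gt0 // => /esym; apply: iter_neq0 => //.
by case: Dq.
Qed.

(** The polynomial [f] has remainder zero modulo itself: the constant term [-d] cancels against the
    reduction of [t^m]. *)
Lemma coord_poly_f_eq0 x y : tw_mul mul sigma (coord x) (coord y) = poly_f one m d -> x ** y = 0.
Proof.
move=> fE; apply: coord_inj; rewrite coordM fE coord0; apply/funext => n.
rewrite /reduce; case: ifP => // nm; have [->|n0] := eqVneq n 0%N.
  by rewrite add0n poly_f_top mul1 /poly_f ltn_eqF // eqxx sub0r addNr.
rewrite [poly_f _ _ _ (n + m)%N]poly_f_gt; last by rewrite -addn1 addnC leq_add2r lt0n.
by rewrite mul0 addr0 /poly_f ltn_eqF // (negPf n0) subr0.
Qed.

Lemma poly_f_irreducible : right_division_ring mul -> tw_irreducible mul one D sigma (poly_f one m d).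
Proof.
move=> [_ divS]; split; first exact: poly_f_nonunit.
move=> [g [h [Dg Dh fE nug nuh]]].
have f0 : poly_f one m d <> fun=> 0.
  by move=> /(congr1 (@^~ m)); rewrite poly_f_top; apply: one_neq0.
have [g0|g0] := pselect (g = fun=> 0).
  apply: f0; rewrite fE g0; apply/funext => n; rewrite /tw_mul big1 // => i _; exact: mul0.
have [h0|h0] := pselect (h = fun=> 0).
  by apply: f0; rewrite fE h0; apply/funext => n; rewrite /tw_mul big1 // => i _; rewrite iter0 mulr0.
have [a [ga gtop]] := Dpoly_degree Dg g0; have [b [hb htop]] := Dpoly_degree Dh h0.
(* A factor of degree zero is a nonzero constant, hence a unit. *)
have [a0|a_gt0] := posnP a; first by apply: nug; apply: const_unit; rewrite -?a0.
have [b0|b_gt0] := posnP b; first by apply: nuh; apply: const_unit; rewrite -?b0.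
have fab : poly_f one m d (a + b)%N <> 0.
  rewrite fE tw_mul_top // => /D_eq0[||//|]; first by case: Dg.
    by apply: D_iter; case: Dh.
  by apply: iter_neq0 => //; case: Dh.
(* The leading coefficients multiply to a nonzero element. As both degrees are positive, each is
   below [m], so [g] and [h] are coordinates of elements of [S]. *)
have abm : (a + b <= m)%N by rewrite leqNgt; apply/negP => /poly_f_gt.
have am : (a < m)%N by rewrite (leq_trans _ abm) // -addn1 leq_add2l.
have bm : (b < m)%N by rewrite (leq_trans _ abm) // -add1n leq_add2r.
pose ev (p : tpoly) := \sum_(i < m) p i ** (t ^^ i).
have evg : coord (ev g) = g.
  by apply: coord_sum => [i|i mi]; [case: Dg | apply: gtop; apply: leq_trans mi].
have evh : coord (ev h) = h.
  by apply: coord_sum => [i|i mi]; [case: Dh | apply: htop; apply: leq_trans mi].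
have ev0 : ev g ** ev h = 0 by apply: coord_poly_f_eq0; rewrite evg evh fE.
have evh0 : ev h <> 0 by move=> e0; apply: h0; rewrite -evh e0 coord0.
(* Right multiplication by the nonzero element [ev h] is injective and kills [ev g]. *)
apply: g0; rewrite -evg -coord0; congr coord.
by apply: (bij_inj (divS _ evh0)); rewrite ev0 mul0.
Qed.

(** * The automorphism defined by a root of unity *)

Section RootOfUnity.
Variable omega : S.
Hypotheses (omegaC : center mul D omega) (sigma_omega : sigma omega = omega)
  (omega_m : npow mul one omega m = one)
  (omega_prim : forall k, (0 < k < m)%N -> npow mul one omega k <> one).

Local Notation "'w_' n" := (npow mul one omega n) (at level 8, n at level 2).

Lemma omega_pow_central n : center mul D (w_ n).
Proof.
have [Dw wC] := omegaC; elim: n => [|n [Dn nC]] /=.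
  by split=> [|a Da]; [apply: D1 | rewrite mul1 mulr1].
split=> [|a Da]; first exact: DM.
by rewrite modS // nC // -modS // wC // modS.
Qed.

Lemma D_omega_pow n : D (w_ n). Proof. by case: (omega_pow_central n). Qed.

Lemma omega_powD i j : w_ (i + j) = w_ i ** w_ j.
Proof.
elim: i => [|i IHi]; first by rewrite mul1.
by rewrite addSn /= IHi modS //; [case: omegaC | apply: D_omega_pow].
Qed.

Lemma iter_omega_pow i n : iter i sigma (w_ n) = w_ n.
Proof.
elim: i => //= i ->; elim: n => [|n IHn] /=; first exact: sigma1.
by rewrite sigmaM ?sigma_omega ?IHn //; [case: omegaC | apply: D_omega_pow].
Qed.

Lemma omega_pow_mulm i : w_ (i * m) = one.
Proof. by elim: i => //= i IHi; rewrite mulSn omega_powD IHi omega_m mul1. Qed.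

Definition cyclic_aut x := \sum_(i < m) coord x i ** w_ i ** (t ^^ i).

Lemma coord_cyclic_aut x : coord (cyclic_aut x) = fun i => coord x i ** w_ i.
Proof.
apply: coord_sum => i; first by apply: DM; [apply: D_coord | apply: D_omega_pow].
by move=> mi; rewrite coord_ge ?mul0.
Qed.

Lemma coord_iter_cyclic_aut k x : coord (iter k cyclic_aut x) = fun i => coord x i ** w_ (i * k).
Proof.
elim: k => [|k IHk]; first by apply/funext => i; rewrite muln0 mulr1.
rewrite /= coord_cyclic_aut IHk; apply/funext => i.
by rewrite modS ?mulnSr ?omega_powD //; [apply: D_coord | apply: D_omega_pow].
Qed.

Lemma iter_cyclic_aut_m x : iter m cyclic_aut x = x.
Proof.
apply: coord_inj; rewrite coord_iter_cyclic_aut; apply/funext => i.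
by rewrite omega_pow_mulm mulr1.
Qed.

Lemma coord_t : (1 < m)%N -> coord t 1 = one.
Proof.
move=> m1; have -> : t = \sum_(i < m) (if i == 1%N :> nat then one else 0) ** (t ^^ i).
  rewrite (bigD1 (Ordinal m1)) //= big1 ?addr0 ?mul1 ?mulr1 // => i i1.
  by rewrite ifN ?mul0 //; apply: contra i1.
rewrite (@coord_sum (fun i => if i == 1%N then one else 0)) // => i.
  by case: ifP => _; [apply: D1 | apply: D0].
by move=> mi; rewrite gtn_eqF // (leq_trans m1).
Qed.

(** The [k]-th iterate multiplies the coordinate of [t] at exponent 1 by [omega^k], which differs
    from [one] by primitivity. *)
Lemma iter_cyclic_aut_neq k : (0 < k < m)%N -> iter k cyclic_aut t <> t.
Proof.
move=> km; have m1 : (1 < m)%N by case/andP: km => k0; apply: leq_ltn_trans.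
move=> /(congr1 (fun x => coord x 1%N)); rewrite coord_iter_cyclic_aut coord_t // mul1 mul1n.
exact: omega_prim.
Qed.

(** Substituting [omega t] for [t] is multiplicative on the twisted polynomials: powers of [omega]
    are central in [D] and fixed by [sigma], so [omega^i omega^(n-i)] can be collected on the
    right. *)
Lemma tw_mul_omega (p q : tpoly) n : (forall i, D (p i)) -> (forall i, D (q i)) ->
  tw_mul mul sigma (fun i => p i ** w_ i) (fun i => q i ** w_ i) n =
  tw_mul mul sigma p q n ** w_ n.
Proof.
move=> Dp Dq; rewrite /tw_mul (na_mul_suml ringS); apply: eq_bigr => i _.
have Dw := D_omega_pow; have Diq k := D_iter i (Dq k).
rewrite iterM // iter_omega_pow modS // -[w_ i ** (_ ** _)]modS //.
rewrite (proj2 (omega_pow_central i)) // !modS //.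
by rewrite -omega_powD subnKC // -ltnS.
Qed.

Lemma cyclic_aut_automorphism : ring_automorphism mul one cyclic_aut.
Proof.
have Dw := D_omega_pow.
split.
(* The inverse is the iterate of order [m - 1]. *)
- by exists (iter m.-1 cyclic_aut) => x; rewrite -?iterSr -?iterS prednK // iter_cyclic_aut_m.
- move=> x y; apply: coord_inj.
  rewrite coordD !coord_cyclic_aut coordD; apply/funext => i; exact: mulDl.
- move=> x y; apply: coord_inj.
  rewrite coordM !coord_cyclic_aut coordM; apply/funext => n; rewrite /reduce.
  have Dxy k : D (tw_mul mul sigma (coord x) (coord y) k) by apply: D_tw_mul; apply: D_coord.
  rewrite !tw_mul_omega; try exact: D_coord.
  case: ifP => _; last by rewrite mul0.
  (* Reduction is respected because [omega^(n+m) = omega^n]. *)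
  rewrite omega_powD omega_m mulr1 mulDl !modS //; last exact: D_iter.
  by rewrite (proj2 (omega_pow_central n)) //; apply: D_iter.
apply: coord_inj; rewrite coord_cyclic_aut (coord_scalar D1); apply/funext => -[|n] /=.
  by rewrite mul1.
by rewrite mul0.
Qed.

Lemma cyclic_aut_scalar a : D a -> cyclic_aut a = a.
Proof.
move=> Da; apply: coord_inj; rewrite coord_cyclic_aut (coord_scalar Da).
by apply/funext => -[|n] /=; rewrite ?mulr1 ?mul0.
Qed.

End RootOfUnity.

(** * Right linearity over the center of [D] and left division *)

Lemma coord_mul_scalar x c : D c -> coord (x ** c) = fun n => coord x n ** iter n sigma c.
Proof.
move=> Dc; rewrite -[RHS]coord_sum => [|n|n mn].
- congr coord; rewrite -{1}[x]coordK (na_mul_suml ringS); apply: eq_bigr => i _.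
  have := @monomial_mul (coord x i) c i 0 (D_coord x i) Dc (ltn_ord i) m_gt0.
  by rewrite /= mulr1 addn0 /reduced_pow ltn_ord.
- by apply: DM; [apply: D_coord | apply: D_iter].
- by rewrite coord_ge ?mul0.
Qed.

(** Makes [S] a right module over [D], and so a right vector space over the center of [D]. *)
Lemma mulA_scalar x a b : D a -> D b -> x ** a ** b = x ** (a ** b).
Proof.
move=> Da Db; apply: coord_inj; rewrite !coord_mul_scalar //; last exact: DM.
by apply/funext => n; rewrite iterM // modS //; [apply: D_coord | apply: D_iter].
Qed.

Lemma mulA_center x y c : center mul D c -> x ** (y ** c) = x ** y ** c.
Proof.
move=> [Dc cC]; apply: coord_inj.
rewrite coordM (coord_mul_scalar y Dc) (coord_mul_scalar (x ** y) Dc) coordM; apply/funext => n; rewrite /reduce.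
have Dy := D_coord y; have Dx := D_coord x; have Dit i a := @D_iter i a.
have twE k : tw_mul mul sigma (coord x) (fun i => coord y i ** iter i sigma c) k =
    tw_mul mul sigma (coord x) (coord y) k ** iter k sigma c.
  rewrite /tw_mul (na_mul_suml ringS); apply: eq_bigr => i _.
  rewrite iterM //; last exact: Dit.
  by rewrite -iterD subnKC 1?modS //; [apply: Dit | rewrite -ltnS].
rewrite !twE; case: ifP => _; last by rewrite mul0.
have Dg k : D (tw_mul mul sigma (coord x) (coord y) k) by apply: D_tw_mul.
(* In the folded part [sigma^(n+m)(c) = sigma^n(c)], and this commutes with [sigma^n(d)] because [c]
   commutes with [d]. *)
rewrite mulDl iter_addm // !modS -?iterM ?cC //; exact: Dit.
Qed.

Lemma center_span : central_simple_over_center mul one D ->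
  exists (I : finType) (e : I -> S),
    forall x, right_span mul (center mul D) e (index_enum I) x.
Proof.
move=> [_ _ [n [b [Db spanD]]]].
exists ('I_m * 'I_n)%type, (fun p : 'I_m * 'I_n => (t ^^ p.1) ** b p.2) => x.
(* The map [sigma^(m-i)] inverts [sigma^i] on [D], so [a t^i = t^i sigma^(m-i)(a)] moves
   coefficients to the right of [t^i]. Expanding them over the center gives the generators
   [t^i b_l]. *)
have Dy i := D_iter (m - i) (D_coord x i).
have [c cP] := choice (fun i => spanD _ (Dy i)).
exists (fun p : 'I_m * 'I_n => c p.1 p.2); split; first by move=> p; case: (cP p.1).
rewrite -[LHS]coordK -(pair_bigA _ (fun (i : 'I_m) (l : 'I_n) => (t ^^ i) ** b l ** c i l)) /=.
apply: eq_bigr => i _; have [cC yE] := cP i.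
have -> : coord x i ** (t ^^ i) = (t ^^ i) ** iter (m - i) sigma (coord x i).
  rewrite powt_scalar // -iterD subnKC ?iter_sigma_m //; first exact: D_coord.
  exact: ltnW.
rewrite yE (na_mul_sumr ringS); apply: eq_bigr => l _.
by have [Dc ->] := cC l; rewrite // mulA_scalar.
Qed.

Lemma left_mul_bijective x : central_simple_over_center mul one D ->
  (forall y, x ** y = 0 -> y = 0) -> bijective (mul x).
Proof.
move=> /center_span[I [e spanS]] x_reg.
have x_inj : injective (mul x).
  by move=> y z xyz; apply/subr0_eq/x_reg; rewrite (na_mulBr ringS) xyz subrr.
apply: inj_surj_bijective => //.
apply: (@right_linear_inj_surj _ _ _ ringS (center mul D)) spanS _ _ x_inj.
- by split=> [|a _]; [apply: D0 | rewrite mul0 mulr0].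
- move=> a b [Da aC] [Db bC]; split=> [|c Dc]; first exact: DB.
  by rewrite mulBl (na_mulBr ringS) aC ?bC.
- move=> a b [Da aC] [Db bC]; split=> [|c Dc]; first exact: DM.
  by rewrite modS // bC // -modS // aC // modS.
(* The inverse [b] of a central [a] is central: [b c = b c a b = b a c b = c b]. *)
- move=> a [Da aC] /(DV Da)[b [Db ab ba]]; exists b => //; split=> // c Dc.
  by rewrite -[c in LHS]mulr1 -ab -[c ** (a ** b)]modS // -aC // modS // -[b ** (a ** _)]modS // ba mul1.
- by move=> y a b [Da _] [Db _]; apply: mulA_scalar.
- exact: (na_mulDr ringS).
- by move=> y a aC; apply: mulA_center.
Qed.

(** If [x y = 0] with [y] nonzero, injectivity of right multiplication by [y] forces [x = 0]. Hence
    left multiplication by a nonzero [x] is injective, and finite dimension makes it bijective. *)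
Lemma right_division_division : central_simple_over_center mul one D ->
  right_division_ring mul -> division_ring mul.
Proof.
move=> csD [S0 divS]; split=> // x x0; split; last exact: divS.
apply: left_mul_bijective => // y xy; apply: contrapT => y0; apply: x0.
by apply: (bij_inj (divS _ y0)); rewrite xy mul0.
Qed.

End CyclicAlgebra.

(** * The isomorphism, irreducibility and the cyclic extension combined *)

Theorem theorem4p3
  (S : zmodType) (mul : S -> S -> S) (one : S) (D : S -> Prop) (m : nat)
  (t d : S) (sigma : S -> S)
  (HS : nonassoc_unital_ring mul one)
  (HD : assoc_division_subring mul one D)
  (Hfree : free_left_module_rank mul D m)
  (* (1) *)
  (H1 : is_basis mul D m (npow mul one t))
  (* (2) *)
  (H2 : forall a, D a -> a <> 0 -> exists a', [/\ D a', a' <> 0 & mul t a = mul a' t])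
  (* (3) *)
  (H3 : forall a b c i j k, D a -> D b -> D c -> (i + j < m)%N -> (k < m)%N ->
          assoc mul (mul a (npow mul one t i)) (mul b (npow mul one t j))
                    (mul c (npow mul one t k)) = 0)
  (* (4) *)
  (H4 : D d /\ npow mul one t m = d)
  (* (5) sigma is the map a |-> a' with sigma 0 = 0 *)
  (Hsig_def : sigma 0 = 0 /\
     forall a, D a -> a <> 0 -> [/\ D (sigma a), sigma a <> 0 & mul t a = mul (sigma a) t])
  (Hsig_order : (0 < m)%N /\ (forall a, D a -> iter m sigma a = a) /\
     forall k, (0 < k < m)%N -> exists a, D a /\ iter k sigma a <> a)
  (Hsig_fix : forall a, D a -> (sigma a = a <-> mul t a = mul a t))
  (HDcsa : central_simple_over_center mul one D)
  (Homega : exists omega, [/\ center mul D omega, sigma omega = omega,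
     npow mul one omega m = one
     & forall k, (0 < k < m)%N -> npow mul one omega k <> one]) :
  iso_to_Sf mul one D sigma m d /\
  (right_division_ring mul -> central_simple_over_center mul one D ->
     tw_irreducible mul one D sigma (poly_f one m d) /\
     nonassoc_cyclic_extension mul one D m).
Proof.
case: H4 => Dd powtm; case: Hsig_def => s0 sP; case: Hsig_order => m_gt0 [s_m _].
have [modS _] := Hfree; case: Homega => omega [omC s_om om_m om_prim].
split; first exact: (coord_iso HS HD modS H1 H3 Dd powtm s0 sP m_gt0 s_m).
move=> divS csD; split.
  exact: (poly_f_irreducible HS HD modS H1 H3 Dd powtm s0 sP m_gt0 divS).
split=> //.
  exact: (right_division_division HS HD modS H1 H3 Dd powtm s0 sP m_gt0 s_m csD divS).
(* The generator of the cyclic group is [sum a_i t^i |-> sum a_i omega^i t^i], and [t] witnesses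
   that no smaller positive iterate is the identity. *)
exists (cyclic_aut HD H1 omega); split.
- exact: (cyclic_aut_automorphism HS HD modS H1 H3 Dd powtm s0 sP m_gt0 s_m omC s_om om_m).
- exact: (cyclic_aut_scalar HS HD modS H1 m_gt0 omC).
- exact: (iter_cyclic_aut_m HS HD modS H1 omC om_m).
- by move=> k km; exists t; exact: (iter_cyclic_aut_neq HS modS omC om_prim km).
Qed.
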